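(* In each dimension $n\ge2$ there exists an $S$-integral Apollonian cluster ensemble, where $S$ is specified as follows: (1) if $n$ is even, $S$ is the set of primes dividing $n-1$; (2) if $n$ is odd, $S$ is the set of primes dividing $\frac{n-1}{2}$.
   Context: For a finite set of primes $S$, a rational number is $S$-integral if its denominator (in lowest terms) is divisible only by primes in $S$ (for $S$ empty, this means integral). ''Sphere'' means an $(n-1)$-sphere in $\mathbb R^n$, hyperplanes being allowed as degenerate spheres (passing through $\infty$). An oriented sphere is a sphere with a chosen direction of unit normal; its signed curvature is $b=1/r$ for the inward normal and $b=-1/r$ for the outward normal ($r$ the radius), and its interior is the usual interior for the inward normal and the exterior for the outward normal. An oriented hyperplane has signed curvature $0$ and its interior is the open half-space into which its chosen unit normal points. A Descartes configuration in $\mathbb R^n$ consists of $n+2$ pairwise tangent spheres with all points of tangency distinct (parallel hyperplanes are tangent at $\infty$). It is oriented if its spheres are oriented so that either the interiors of all $n+2$ oriented spheres are pairwise disjoint, or they are pairwise disjoint after reversing all orientations. The augmented curvature-center coordinates of an oriented sphere with signed curvature $b\neq0$ and center $\mathbf x=(x_1,\dots,x_n)$ are $(\bar b,b,bx_1,\dots,bx_n)$ with $\bar b=b|\mathbf x|^2-1/b$; for an oriented hyperplane $\{\mathbf y:\mathbf y\cdot\mathbf h=m\}$ with unit normal $\mathbf h$ they are $(2m,0,h_1,\dots,h_n)$. For an ordered, oriented Descartes configuration $\mathcal D=(S_1,\dots,S_{n+2})$, $\mathbf W_{\mathcal D}$ is the $(n+2)\times(n+2)$ matrix whose $j$-th row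 is the coordinate vector of $S_j$. Known fact: $\mathcal D\mapsto\mathbf W_{\mathcal D}$ is a bijection from ordered, oriented Descartes configurations onto the real matrices $\mathbf W$ with $\mathbf W^T\mathbf Q_{D,n}\mathbf W=\mathbf Q_{W,n}$, where $\mathbf{Q}_{D,n}=\mathbf{I}_{n+2}-\frac1n\mathbf{1}\mathbf{1}^T$ and $\mathbf{Q}_{W,n}=\begin{pmatrix}0&-4&0\\-4&0&0\\0&0&2\mathbf{I}_n\end{pmatrix}$. The Apollonian group $\mathcal A_n$ is generated by the matrices $\mathbf S_j=\mathbf I_{n+2}+\frac{2}{n-1}\mathbf e_j\mathbf 1^T-\frac{2n}{n-1}\mathbf e_j\mathbf e_j^T$, $1\le j\le n+2$, which satisfy $\mathbf S_j^T\mathbf Q_{D,n}\mathbf S_j=\mathbf Q_{D,n}$; it acts on ordered, oriented Descartes configurations by $\mathbf W_{\mathcal D}\mapsto\mathbf U\mathbf W_{\mathcal D}$. An Apollonian cluster ensemble is the orbit under $\mathcal A_n$ of an ordered, oriented Descartes configuration. It is $S$-integral if the signed curvature of every sphere in every Descartes configuration of the orbit is $S$-integral. *)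

(* Defs.v *)
From HB Require Import structures.
From mathcomp Require Import all_boot all_order all_algebra.
From mathcomp Require Import classical_sets reals.

Set Implicit Arguments.
Unset Strict Implicit.
Unset Printing Implicit Defensive.

Import Order.TTheory GRing.Theory Num.Theory.

Local Open Scope classical_set_scope.
Local Open Scope ring_scope.

Section Euclidean.
Variables (R : realType) (n : nat).

Definition dotv (u v : 'rV[R]_n) : R := \sum_(i < n) u 0 i * v 0 i.

(* The library norm on 'rV[R]_n is the sup norm, hence this definition. *)
Definition enorm (u : 'rV[R]_n) : R := Num.sqrt (dotv u u).

Lemma dotvNN (u v : 'rV[R]_n) : dotv (- u) (- v) = dotv u v.
Proof. by apply: eq_bigr => i _; rewrite !mxE mulrNN. Qed.

Lemma unit_normalN (h : 'rV[R]_n) : dotv h h = 1 -> dotv (- h) (- h) = 1.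
Proof. by rewrite dotvNN. Qed.

End Euclidean.

(* [Round c r _ inward] is the sphere of center c and radius r, with the inward
   unit normal iff [inward]; [Hyper h m _] is {y | y . h = m} with normal h. *)
Inductive oriented_sphere (R : realType) (n : nat) : Type :=
| Round (c : 'rV[R]_n) (r : R) of 0 < r & bool
| Hyper (h : 'rV[R]_n) (m : R) of dotv h h = 1.

Section Spheres.
Variables (R : realType) (n : nat).
Implicit Types S T : oriented_sphere R n.

Definition reverse S : oriented_sphere R n :=
  match S with
  | Round c r r_gt0 inward => Round c r_gt0 (~~ inward)
  | Hyper h m h1 => Hyper (- m) (unit_normalN h1)
  end.

Definition curvature S : R :=
  match S with
  | Round _ r _ inward => if inward then r^-1 else - r^-1
  | Hyper _ _ _ => 0
  end.

Definition interior S : set 'rV[R]_n :=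
  match S with
  | Round c r _ inward =>
      if inward then [set y | enorm (y - c) < r] else [set y | r < enorm (y - c)]
  | Hyper h m _ => [set y | m < dotv y h]
  end.

(* The underlying point set in R^n together with the point at infinity [None]. *)
Definition points S : set (option 'rV[R]_n) :=
  [set p | match S, p with
           | Round c r _ _, Some y => enorm (y - c) = r
           | Round _ _ _ _, None => False
           | Hyper h m _, Some y => dotv y h = m
           | Hyper _ _ _, None => True
           end].

(* For n >= 2, two spheres (hyperplanes included) are tangent when they meet in
   exactly one point, which is [None] for parallel hyperplanes. *)
Definition tangent_at (p : option 'rV[R]_n) S T : Prop :=
  points S `&` points T = [set p].

Definition tangent S T : Prop := exists p, tangent_at p S T.

(* (\bar b, b, b x_1, ..., b x_n), resp. (2 m, 0, h_1, ..., h_n). *)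
Definition coordinates S : 'rV[R]_(1 + (1 + n)) :=
  match S with
  | Round c _ _ _ =>
      let b := curvature S in
      row_mx (b * enorm c ^+ 2 - b^-1)%:M (row_mx b%:M (b *: c))
  | Hyper h m _ => row_mx (2%:R * m)%:M (row_mx 0%:M h)
  end.

End Spheres.

Definition ordered_configuration (R : realType) (n : nat) : Type :=
  'I_n.+2 -> oriented_sphere R n.

Section Configurations.
Variables (R : realType) (n : nat).
Implicit Types D : ordered_configuration R n.

Definition descartes D : Prop :=
  (forall i j, i != j -> tangent (D i) (D j)) /\
  (forall i j k l p, i != j -> k != l ->
     tangent_at p (D i) (D j) -> tangent_at p (D k) (D l) ->
     [set i; j]%SET = [set k; l]%SET).

Definition disjoint_interiors D : Prop :=
  forall i j, i != j -> interior (D i) `&` interior (D j) = set0.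

Definition oriented_descartes D : Prop :=
  descartes D /\
  (disjoint_interiors D \/ disjoint_interiors (fun i => reverse (D i))).

Definition Wmx D : 'M[R]_n.+2 := \matrix_(j < n.+2) coordinates (D j).

Definition apollonian_gen (j : 'I_n.+2) : 'M[R]_n.+2 :=
  let e : 'cV[R]_n.+2 := delta_mx j 0 in
  let one : 'cV[R]_n.+2 := const_mx 1 in
  1%:M + (2%:R / (n%:R - 1)) *: (e *m one^T)
       - (2%:R * n%:R / (n%:R - 1)) *: (e *m e^T).

Inductive apollonian_group : 'M[R]_n.+2 -> Prop :=
| apollonian_one : apollonian_group 1%:M
| apollonian_generator j : apollonian_group (apollonian_gen j)
| apollonian_mul U V :
    apollonian_group U -> apollonian_group V -> apollonian_group (U *m V)
| apollonian_inv U : apollonian_group U -> apollonian_group (invmx U).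

(* U maps D to the configuration D' determined by W_D' = U W_D; the action is
   well defined because D |-> W_D is a bijection from oriented Descartes
   configurations onto the solutions of W^T Q_D W = Q_W, a set stable under left
   multiplication by the group. *)
Definition apollonian_orbit D : set (ordered_configuration R n) :=
  [set D' | oriented_descartes D' /\
            exists2 U, apollonian_group U & Wmx D' = U *m Wmx D].

Definition apollonian_cluster_ensemble (E : set (ordered_configuration R n)) :
    Prop :=
  exists2 D, oriented_descartes D & E = apollonian_orbit D.

End Configurations.

Definition S_integral (R : realType) (S : seq nat) (x : R) : Prop :=
  exists2 q : rat, x = ratr q &
    forall p : nat, prime p -> (p %| `|denq q|)%N -> p \in S.

Definition S_integral_ensemble (R : realType) (n : nat) (S : seq nat)
    (E : set (ordered_configuration R n)) : Prop :=
  forall D, E D -> forall i, S_integral S (curvature (D i)).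

(* Main.v *)
(** The generators of the Apollonian group are involutions whose entries are
    integral combinations of [1] and [2 / (n - 1)], and this number is
    [S]-integral for the prescribed [S]; hence every element of the group has
    [S]-integral entries, and one Descartes configuration with integral
    curvatures suffices.  Take [n] unit spheres centered at the points
    [sqrt 2 e_i], which are at mutual distance [2] and lie on a hyperplane
    orthogonal to [(1, ..., 1)], together with the two hyperplanes parallel to
    it at distance [1]: the curvatures are [0, 0, 1, ..., 1]. *)
Require Import Defs.
From HB Require Import structures.
From mathcomp Require Import all_boot all_order all_algebra.
From mathcomp Require Import ring lra.
From mathcomp Require Import classical_sets reals.

Set Implicit Arguments.
Unset Strict Implicit.
Unset Printing Implicit Defensive.

Local Open Scope ring_scope.
Import Order.TTheory GRing.Theory Num.Theory.

(** * The ring of [S]-integral numbers *)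

Section SIntegers.
Variables (R : realType) (S : seq nat).

(** Here the fraction need not be in lowest terms, so sums and products can be handled with the
    common denominator [d * e]. *)
Lemma S_integralP (x : R) :
  S_integral S x <->
  exists m : int, exists2 d : nat, (0 < d)%N /\ x = m%:~R / d%:R &
    forall p, prime p -> (p %| d)%N -> p \in S.
Proof.
split=> [[q -> qS]|[m [d [d_gt0 ->] dS]]].
  exists (numq q), `|denq q|%N => //; split; first by rewrite absz_gt0 denq_neq0.
  by rewrite /ratr natr_absz ger0_norm // denq_ge0.
have d_neq0 : d%:Q != 0 by rewrite intr_eq0 -lt0n.
exists (m%:Q / d%:Q); first by rewrite [RHS]fmorph_div /= !ratr_int.
set q := _ / _ => p p_pr pq; apply: dS => //; apply: dvdn_trans pq _.
(* The reduced denominator divides [d] by Gauss's lemma, since it is coprime to the numerator. *)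
have num_den : numq q * d = m * denq q.
  by apply: (@intr_inj rat); rewrite !intrM numqE mulrAC divfK.
have : (denq q %| numq q * d)%Z by rewrite num_den dvdz_mull.
by rewrite Gauss_dvdzr // coprimezE coprime_sym coprime_num_den.
Qed.

Lemma S_integral_int (m : int) : S_integral S (m%:~R : R).
Proof.
apply/S_integralP; exists m, 1%N; first by rewrite divr1.
by move=> p p_pr; rewrite dvdn1 => /eqP p1; rewrite p1 in p_pr.
Qed.

Lemma S_integralD (x y : R) :
  S_integral S x -> S_integral S y -> S_integral S (x + y).
Proof.
move=> /S_integralP[m [d [d0 ->] dS]] /S_integralP[k [e [e0 ->] eS]].
apply/S_integralP; exists (m * e + k * d), (d * e)%N; last first.
  by move=> p p_pr; rewrite Euclid_dvdM // => /orP[/dS|/eS]; apply.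
split; first by rewrite muln_gt0 d0.
rewrite addf_div ?pnatr_eq0 -?lt0n //.
by rewrite natrM intrD !intrM.
Qed.

Lemma S_integralM (x y : R) :
  S_integral S x -> S_integral S y -> S_integral S (x * y).
Proof.
move=> /S_integralP[m [d [d0 ->] dS]] /S_integralP[k [e [e0 ->] eS]].
apply/S_integralP; exists (m * k), (d * e)%N; last first.
  by move=> p p_pr; rewrite Euclid_dvdM // => /orP[/dS|/eS]; apply.
split; first by rewrite muln_gt0 d0.
by rewrite mulf_div natrM intrM.
Qed.

Definition S_integral_mx {m n : nat} (A : 'M[R]_(m, n)) : Prop :=
  forall i j, S_integral S (A i j).

Lemma S_integral_mxM (m n p : nat) (A : 'M[R]_(m, n)) (B : 'M[R]_(n, p)) :
  S_integral_mx A -> S_integral_mx B -> S_integral_mx (A *m B).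
Proof.
move=> AS BS i j; rewrite mxE; elim/big_ind: _ => [|x y|k _].
- exact: (S_integral_int 0).
- exact: S_integralD.
- exact: S_integralM.
Qed.

End SIntegers.

(** * Integrality of the Apollonian group and of its orbits *)

Section ApollonianGroup.
Variables (R : realType) (n : nat).
Hypothesis n_ge2 : (2 <= n)%N.

Let n1_neq0 : n%:R - 1 != 0 :> R.
Proof. by rewrite subr_eq0 pnatr_eq1 gtn_eqF. Qed.

(* [S_j = 1 + e_j w] for a row [w] with [w e_j = -2]. *)
Lemma apollonian_gen_involution (j : 'I_n.+2) :
  apollonian_gen R j *m apollonian_gen R j = 1%:M.
Proof.
rewrite /apollonian_gen.
set e := delta_mx j 0; set one := const_mx 1.
set a := _ / _; set b := _ / _.
pose w : 'rV[R]_n.+2 := a *: one^T - b *: e^T.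
have -> : 1%:M + a *: (e *m one^T) - b *: (e *m e^T) = 1%:M + e *m w.
  by rewrite mulmxBr -!scalemxAr addrA.
have we : w *m e = (- 2)%:M.
  apply/matrixP=> i k; rewrite !ord1 mulmxBl -!scalemxAl !mxE.
  rewrite (bigD1 j) //= big1 => [|l /negPf lj]; last by rewrite !mxE lj mulr0.
  rewrite (bigD1 j) //= big1 => [|l /negPf lj]; last by rewrite !mxE lj mulr0.
  by rewrite !mxE !eqxx /= /a /b; field.
rewrite mulmxDl mul1mx mulmxDr mulmx1 mulmxA -(mulmxA e w) we mul_mx_scalar.
rewrite -scalemxAl -addrA -{1 2}[e *m w]scale1r -!scalerDl.
by rewrite (_ : 1 + (1 - 2) = 0) ?scale0r ?addr0 //; ring.
Qed.

Variable S : seq nat.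
Hypothesis S_int : S_integral S (2 / (n%:R - 1) : R).

Lemma S_integral_apollonian_gen (j : 'I_n.+2) : S_integral_mx S (apollonian_gen R j).
Proof.
move=> i k; rewrite /apollonian_gen !mxE !big_ord1 !mxE.
rewrite (mulrAC 2 n%:R); set a := 2 / _.
(* With [a = 2 / (n - 1)] factored out, only integers remain. *)
rewrite (_ : _ + _ = (i == k)%:~R + a * ((i == j)%:Z -
  n%:Z * ((i == j)%:Z * (k == j)%:Z))%:~R); last first.
  by rewrite eqxx !andbT rmorphB !rmorphM /=; ring.
by apply: S_integralD (S_integral_int _ _ _) _; apply: S_integralM => //;
  apply: S_integral_int.
Qed.

Lemma S_integral_apollonian_group (U : 'M[R]_n.+2) :
  apollonian_group U -> S_integral_mx S U.
Proof.
(* The group is closed under [invmx], so the induction must also carry the integrality of the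
   inverse; invertibility is what makes the inverse of a product factor. *)
suff H : apollonian_group U -> [/\ U \in unitmx, S_integral_mx S U &
    S_integral_mx S (invmx U)] by move=> /H[].
have one_int : S_integral_mx S (1%:M : 'M[R]_n.+2).
  by move=> i k; rewrite mxE; apply: (S_integral_int _ _ (i == k)).
elim=> {U} [|j|U V _ [Uu US UVS] _ [Vu VS VVS]|U _ [Uu US UVS]].
- by rewrite invmx1 unitmx1.
- have [gu _] := mulmx1_unit (apollonian_gen_involution j).
  have -> : invmx (apollonian_gen R j) = apollonian_gen R j.
    by rewrite -[LHS]mulmx1 -(apollonian_gen_involution j) mulKmx.
  by split=> //; apply: S_integral_apollonian_gen.
- have UVu : U *m V \in unitmx by rewrite unitmx_mul Uu.
  split=> //; first exact: S_integral_mxM.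
  have -> : invmx (U *m V) = invmx V *m invmx U by exact: invrM.
  exact: S_integral_mxM.
- by rewrite unitmx_inv invmxK.
Qed.

(** The shifted index is column 1, which follows the column of the coordinate [\bar b]. *)
Lemma Wmx_curvature (D : ordered_configuration R n) i :
  Wmx D i (rshift 1 (@lshift 1 n 0)) = curvature (D i).
Proof.
rewrite mxE /coordinates; case: (D i) => [c r r0 b|h m h1] /=;
  by rewrite (row_mxEr _ (row_mx _ _)) row_mxEl mxE.
Qed.

(** Left multiplication by [U] acts on each column separately, so the new curvatures are
    combinations of the old ones with coefficients from [U]. *)
Lemma S_integral_orbit (D : ordered_configuration R n) :
  (forall i, S_integral S (curvature (D i))) ->
  S_integral_ensemble S (apollonian_orbit D).
Proof.
move=> DS D' [_ [U GU WD']] i; pose c : 'I_n.+2 := rshift 1 (@lshift 1 n 0).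
have -> : curvature (D' i) = (U *m col c (Wmx D)) i 0.
  by rewrite -Wmx_curvature WD' !mxE; apply: eq_bigr => k _; rewrite [in RHS]mxE.
apply: S_integral_mxM => [|k l]; first exact: S_integral_apollonian_group.
by rewrite mxE Wmx_curvature.
Qed.

End ApollonianGroup.

(** * Disjointness and tangency of unit spheres and hyperplanes *)

Section EuclideanSpheres.
Variables (R : realType) (n : nat).
Implicit Types u v h c d y : 'rV[R]_n.

Lemma dotvC u v : dotv u v = dotv v u.
Proof. by apply: eq_bigr => i _; rewrite mulrC. Qed.

Lemma dotvDl u v y : dotv (u + v) y = dotv u y + dotv v y.
Proof. by rewrite -big_split; apply: eq_bigr => i _; rewrite mxE mulrDl. Qed.

Lemma dotvZl (a : R) u y : dotv (a *: u) y = a * dotv u y.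
Proof. by rewrite mulr_sumr; apply: eq_bigr => i _; rewrite mxE mulrA. Qed.

Lemma dotvNl u y : dotv (- u) y = - dotv u y.
Proof. by rewrite -scaleN1r dotvZl mulN1r. Qed.

Lemma dotv_sqrD u v : dotv (u + v) (u + v) = dotv u u + 2 * dotv u v + dotv v v.
Proof. by rewrite dotvDl ![dotv _ (u + v)]dotvC !dotvDl (dotvC v u); ring. Qed.

Lemma dotv_sqrB u v : dotv (u - v) (u - v) = dotv u u - 2 * dotv u v + dotv v v.
Proof. by rewrite dotv_sqrD dotvNN [dotv u (- v)]dotvC dotvNl dotvC; ring. Qed.

Lemma dotv_ge0 u : 0 <= dotv u u.
Proof. by apply: sumr_ge0 => i _; rewrite -expr2 sqr_ge0. Qed.

Lemma dotv_eq0 u : dotv u u = 0 -> u = 0.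
Proof.
move=> /eqP; rewrite psumr_eq0 => [/allP u0|i _]; last by rewrite -expr2 sqr_ge0.
apply/rowP=> i; rewrite mxE; apply/eqP; rewrite -sqrf_eq0 expr2.
by apply: u0; rewrite mem_index_enum.
Qed.

Lemma enorm_eq1 u : enorm u = 1 <-> dotv u u = 1.
Proof.
split=> u1; last by rewrite /enorm u1 sqrtr1.
by rewrite -(sqr_sqrtr (dotv_ge0 u)) -/(enorm u) u1 expr1n.
Qed.

Lemma enorm_lt1 u : (enorm u < 1) = (dotv u u < 1).
Proof. by rewrite -[1 in LHS]sqrtr1 ltr_sqrt. Qed.

(** By the parallelogram law, a common point would make the squared norm of [(y - c) + (y - d)] less
    than 2 + 2 - 4 = 0. *)
Lemma interiorI_unit_spheres c d (r : 0 < 1 :> R) :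
  dotv (c - d) (c - d) = 4 ->
  (interior (Round c r true) `&` interior (Round d r true))%classic = set0.
Proof.
move=> cd; apply/seteqP; split=> // y [] /=; rewrite !enorm_lt1 => yc yd.
have := dotv_ge0 ((y - d) + (y - c)); move: cd.
rewrite (_ : c - d = (y - d) - (y - c)); last by rewrite opprB [RHS]addrC subrKA.
by rewrite dotv_sqrB (dotv_sqrD (y - d)); lra.
Qed.

(** The equality case of the parallelogram law: [y] must be the midpoint of the centers. *)
Lemma unit_spheres_meet c d y :
  dotv (c - d) (c - d) = 4 -> dotv (y - c) (y - c) = 1 ->
  dotv (y - d) (y - d) = 1 -> (y - c) + (y - d) = 0.
Proof.
move=> + yc yd; rewrite (_ : c - d = (y - d) - (y - c)); last first.
  by rewrite opprB [RHS]addrC subrKA.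
by rewrite dotv_sqrB => cd; apply: dotv_eq0; rewrite dotv_sqrD (dotvC (y - c)); lra.
Qed.

Lemma tangent_unit_spheres c d (r : 0 < 1 :> R) :
  dotv (c - d) (c - d) = 4 -> tangent (Round c r true) (Round d r true).
Proof.
move=> cd; exists (Some (2^-1 *: (c + d))).
apply/seteqP; split=> [[y|] []//= /enorm_eq1 yc /enorm_eq1 yd|_ ->].
  have yE := unit_spheres_meet cd yc yd; congr Some.
  have {yE} : 2 *: y = c + d.
    by apply/eqP; rewrite -subr_eq0 -yE opprD addrACA scaler_nat mulr2n.
  by move=> <-; rewrite scalerA mulVf ?scale1r // pnatr_eq0.
split; apply/enorm_eq1.
  rewrite (_ : _ - c = - (2^-1 *: (c - d))).
    by rewrite dotvNN dotvZl dotvC dotvZl cd; lra.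
  by apply/rowP=> i; rewrite !mxE; lra.
rewrite (_ : _ - d = 2^-1 *: (c - d)); first by rewrite dotvZl dotvC dotvZl cd; lra.
by apply/rowP=> i; rewrite !mxE; lra.
Qed.

(** The condition on [m] makes the hyperplane touch the sphere at [c + h]; a common interior point
    [y] would give [y - c - h] a squared norm below 1 - 2 + 1 = 0. *)
Lemma interiorI_hyperplane_unit_sphere c h m (h1 : dotv h h = 1) (r : 0 < 1 :> R) :
  m = dotv c h + 1 ->
  (interior (Hyper m h1) `&` interior (Round c r true))%classic = set0.
Proof.
move=> ->; apply/seteqP; split=> // y [] /=; rewrite enorm_lt1 => yh yc.
have := dotv_ge0 ((y - c) - h); rewrite dotv_sqrB (dotvDl y (- c) h) dotvNl; lra.
Qed.

Lemma hyperplane_unit_sphere_meet c h y :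
  dotv h h = 1 -> dotv y h = dotv c h + 1 -> dotv (y - c) (y - c) = 1 ->
  y = c + h.
Proof.
move=> h1 yh yc; apply/eqP; rewrite -subr_eq0 opprD addrA; apply/eqP/dotv_eq0.
by rewrite dotv_sqrB (dotvDl y (- c) h) dotvNl; lra.
Qed.

Lemma tangent_hyperplane_unit_sphere c h m (h1 : dotv h h = 1) (r : 0 < 1 :> R) :
  m = dotv c h + 1 -> tangent (Hyper m h1) (Round c r true).
Proof.
move=> ->; exists (Some (c + h)).
apply/seteqP; split=> [[y|] []//= yh /enorm_eq1 yc|_ ->].
  by congr Some; apply: hyperplane_unit_sphere_meet.
by split=> /=; rewrite ?dotvDl ?h1 //; apply/enorm_eq1; rewrite addrC addKr.
Qed.

Lemma tangentC (S T : oriented_sphere R n) : tangent S T -> tangent T S.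
Proof. by move=> [p pP]; exists p; rewrite /tangent_at setIC. Qed.

End EuclideanSpheres.

(** * The strip configuration *)

Section StripConfiguration.
Variables (R : realType) (n : nat).
Hypothesis n_gt0 : (0 < n)%N.

Definition strip_center (i : 'I_n) : 'rV[R]_n := Num.sqrt 2 *: delta_mx 0 i.

Definition strip_normal (b : 'I_2) : 'rV[R]_n :=
  (-1) ^+ b *: const_mx (Num.sqrt n%:R)^-1.

Lemma strip_normal1 b : dotv (strip_normal b) (strip_normal b) = 1.
Proof.
rewrite /strip_normal dotvZl dotvC dotvZl mulrA -expr2 sqrr_sign mul1r.
rewrite /dotv (eq_bigr (fun=> n%:R^-1)) => [|i _].
  by rewrite sumr_const card_ord -[_ *+ n]mulr_natl mulfV // pnatr_eq0 -lt0n.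
by rewrite !mxE -expr2 exprVn sqr_sqrtr // ler0n.
Qed.

(** Every center has the same product, plus or minus [sqrt 2 / sqrt n], with a given normal; adding
    1 makes the hyperplane touch all the unit spheres, its normal pointing away from them. *)
Definition strip_sphere (x : 'I_2 + 'I_n) : oriented_sphere R n :=
  match x with
  | inl b => Hyper ((-1) ^+ b * (Num.sqrt 2 / Num.sqrt n%:R) + 1) (strip_normal1 b)
  | inr i => Round (strip_center i) ltr01 true
  end.

Definition strip : ordered_configuration R n :=
  fun i => strip_sphere (split (i : 'I_(2 + n))).

Lemma dotv_delta (i : 'I_n) (v : 'rV[R]_n) : dotv (delta_mx 0 i) v = v 0 i.
Proof.
rewrite /dotv (bigD1 i) //= big1 => [|j /negPf ji]; rewrite mxE ?ji ?mul0r //.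
by rewrite !eqxx mul1r addr0.
Qed.

Lemma strip_center_normal i b :
  dotv (strip_center i) (strip_normal b) = (-1) ^+ b * (Num.sqrt 2 / Num.sqrt n%:R).
Proof. by rewrite dotvZl dotv_delta !mxE mulrCA. Qed.

Lemma strip_center_dist i j : i != j ->
  dotv (strip_center i - strip_center j) (strip_center i - strip_center j) = 4.
Proof.
move=> /negPf ij; rewrite dotv_sqrB /strip_center.
rewrite !dotvZl ![dotv (delta_mx _ _) _]dotv_delta !mxE !eqxx ij /=.
by have := @sqr_sqrtr R 2 (ler0n _ 2); rewrite expr2 => s2; lra.
Qed.

Lemma strip_normal_opp a b : a != b -> strip_normal b = - strip_normal a.
Proof.
rewrite /strip_normal -scaleNr => ab; congr (_ *: _).
case: a b ab => [[|[|//]] ?] [[|[|//]] ?] //= _;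
  by rewrite expr0 expr1 ?opprK.
Qed.

(** Normals and offsets are opposite up to the two added units, so the inequalities sum to 0 >= 2.
    Being weak, they serve both for interiors and for the hyperplanes themselves. *)
Lemma strip_hyperplanes_disjoint (a b : 'I_2) (y : 'rV[R]_n) : a != b ->
  dotv y (strip_normal a) >= (-1) ^+ a * (Num.sqrt 2 / Num.sqrt n%:R) + 1 ->
  dotv y (strip_normal b) >= (-1) ^+ b * (Num.sqrt 2 / Num.sqrt n%:R) + 1 -> False.
Proof.
move=> ab; rewrite (strip_normal_opp ab) [dotv y (- _)]dotvC dotvNl (dotvC _ y).
set s := _ / _ => ya yb.
have : (-1) ^+ b * s = - ((-1) ^+ a * s).
  (* The sign change is read off from the products of one center with the two normals. *)
  pose i := Ordinal n_gt0.
  by rewrite -!(strip_center_normal i) (strip_normal_opp ab) dotvC dotvNl dotvC.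
by lra.
Qed.

Lemma strip_sphere_tangent x y : x != y -> tangent (strip_sphere x) (strip_sphere y).
Proof.
case: x y => [a|i] [b|j] xy /=.
- exists None; apply/seteqP; split=> [[y|] [] //= ya yb|_ -> //].
  by case: (@strip_hyperplanes_disjoint a b y xy); rewrite ?ya ?yb.
- by apply: tangent_hyperplane_unit_sphere; rewrite strip_center_normal.
- by apply/tangentC/tangent_hyperplane_unit_sphere; rewrite strip_center_normal.
- exact/tangent_unit_spheres/strip_center_dist.
Qed.

Lemma strip_sphere_disjoint x y : x != y ->
  (interior (strip_sphere x) `&` interior (strip_sphere y))%classic = set0.
Proof.
case: x y => [a|i] [b|j] xy.
- apply/seteqP; split=> // y [/= ya yb].
  by case: (@strip_hyperplanes_disjoint a b y xy); apply: ltW.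
- by apply: interiorI_hyperplane_unit_sphere; rewrite strip_center_normal.
- by rewrite setIC; apply: interiorI_hyperplane_unit_sphere; rewrite strip_center_normal.
- exact/interiorI_unit_spheres/strip_center_dist.
Qed.

(** A hyperplane touches each sphere at its center plus the normal, and the centers are distinct. *)
Lemma strip_hyperplane_points2 a i j p : i != j ->
  points (strip_sphere (inl a)) p -> points (strip_sphere (inr i)) p ->
  points (strip_sphere (inr j)) p -> False.
Proof.
case: p => [y|//] ij /= ya /enorm_eq1 yi /enorm_eq1 yj.
have yE k : dotv (y - strip_center k) (y - strip_center k) = 1 ->
    y = strip_center k + strip_normal a.
  by apply: hyperplane_unit_sphere_meet; rewrite ?strip_normal1 ?strip_center_normal.
have /addIr cij : strip_center i + strip_normal a = strip_center j + strip_normal a.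
  by rewrite -yE // -yE.
have := strip_center_dist ij; rewrite cij subrr -[X in dotv X](scale0r 0) dotvZl.
by lra.
Qed.

(** The hyperplanes meet only at infinity, which lies on no round sphere. *)
Lemma strip_hyperplanes_points a b i p : a != b ->
  points (strip_sphere (inl a)) p -> points (strip_sphere (inl b)) p ->
  points (strip_sphere (inr i)) p -> False.
Proof.
case: p => [y|//] ab /= ya yb _.
by case: (@strip_hyperplanes_disjoint a b y ab); rewrite ?ya ?yb.
Qed.

(** This is what makes the points of tangency distinct. *)
Lemma strip_sphere_points3 x y z p : x != y -> y != z -> z != x ->
  points (strip_sphere x) p -> points (strip_sphere y) p ->
  points (strip_sphere z) p -> False.
Proof.
case: x y z => [a|i] [b|j] [c|k] xy yz zx px py pz.
- by move: a b c xy yz zx {px py pz} => [[|[|//]] ?] [[|[|//]] ?] [[|[|//]] ?].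
- exact: (@strip_hyperplanes_points a b k p).
- exact: (@strip_hyperplanes_points c a j p).
- exact: (@strip_hyperplane_points2 a j k p).
- exact: (@strip_hyperplanes_points b c i p).
- exact: (@strip_hyperplane_points2 b k i p).
- exact: (@strip_hyperplane_points2 c i j p).
case: p px py pz => [p|//] /= /enorm_eq1 pi /enorm_eq1 pj /enorm_eq1 pk.
(* The three vectors from the centers to [p] have pairwise sum 0, hence vanish, although their norm
   is 1. *)
have ij := unit_spheres_meet (strip_center_dist xy) pi pj.
have jk := unit_spheres_meet (strip_center_dist yz) pj pk.
have ki := unit_spheres_meet (strip_center_dist zx) pk pi.
have pi0 : p - strip_center i = 0.
  apply/rowP=> l; move/rowP/(_ l): ij; move/rowP/(_ l): jk; move/rowP/(_ l): ki.
  by rewrite !mxE; lra.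
by move: pi; rewrite pi0 -[X in dotv X](scale0r 0) dotvZl; lra.
Qed.

Lemma strip_descartes : oriented_descartes strip.
Proof.
have split_inj : injective (@split 2 n) by apply: can_inj (@splitK _ _).
split; last first.
  by left=> i j ij; apply: strip_sphere_disjoint; rewrite (inj_eq split_inj).
split=> [i j ij|i j k l p ij kl pij pkl].
  by apply: strip_sphere_tangent; rewrite (inj_eq split_inj).
have [pi pj] : points (strip i) p /\ points (strip j) p.
  by have : (points (strip i) `&` points (strip j))%classic p by rewrite pij.
have [pk pl] : points (strip k) p /\ points (strip l) p.
  by have : (points (strip k) `&` points (strip l))%classic p by rewrite pkl.
(* No third sphere passes through [p], so [{k, l}] lies in [{i, j}]; both have two elements. *)
have third m : points (strip m) p -> m \in [set i; j]%SET.
  move=> pm; rewrite !inE; apply/negPn/negP; rewrite negb_or => /andP[mi mj].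
  apply: (@strip_sphere_points3 (@split 2 n i) (@split 2 n j) (@split 2 n m) p) => //;
    by rewrite (inj_eq split_inj) // eq_sym.
apply/esym/eqP; rewrite eqEcard !cards2 ij kl leqnn andbT.
by apply/fintype.subsetP=> m; rewrite !inE => /orP[] /eqP ->; rewrite -in_set2 third.
Qed.

Lemma strip_curvature S i : S_integral S (curvature (strip i)).
Proof.
rewrite /strip; case: split => [b|k] /=; first exact: (S_integral_int _ _ 0).
by rewrite invr1; apply: (S_integral_int _ _ 1).
Qed.

End StripConfiguration.

(** * The number [2 / (n - 1)] and the conclusion *)

Lemma S_integral_two_div (R : realType) (n : nat) : (2 <= n)%N ->
  S_integral (if odd n then primes n.-1./2 else primes n.-1)
    (2 / (n%:R - 1) : R).
Proof.
case: n => [|n] // n_gt0; rewrite -[n.+1%:R]natr1 addrK /=; apply/S_integralP.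
(* From here [n] is the dimension minus one. If it is even, the numerator 2 cancels and the
   denominator is [n./2]; otherwise the denominator is [n]. *)
case: ifP => [n_even|_]; last first.
  by exists 2, n => // p p_pr pn; rewrite mem_primes p_pr pn andbT.
have nE : n = (2 * n./2)%N by rewrite mul2n even_halfK.
have half_gt0 : (0 < n./2)%N by move: n_gt0; rewrite ltnS {1}nE muln_gt0.
exists 1, n./2 => [|p p_pr pn]; last by rewrite mem_primes p_pr half_gt0.
by split=> //; rewrite {1}nE natrM invfM mulrA mulfV ?pnatr_eq0.
Qed.

Theorem theorem6p1 (R : realType) (n : nat) (hn : (2 <= n)%N) :
  exists E : set (ordered_configuration R n),
    apollonian_cluster_ensemble E /\
    S_integral_ensemble
      (if odd n then primes (n.-1)./2 else primes n.-1) E.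
Proof.
have n_gt0 := ltnW hn.
exists (apollonian_orbit (strip R n_gt0)); split.
  by exists (strip R n_gt0); first exact: strip_descartes.
apply: S_integral_orbit => //; first exact: S_integral_two_div.
exact: strip_curvature.
Qed.
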